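(* Let $(X,\mathcal{I})$ be a matroid on a finite set $X$ whose maximal sets have cardinality $K\ge 1$, and let $1\le k\le K$. Let $f:2^X\to\mathbb{R}$ be a polymatroid set function with total curvature $c\in(0,1]$ and total $k$-batch curvature $c_k$. Let $O\in\operatorname{argmax}_{M\in\mathcal{I}} f(M)$ be any optimal solution, with $f(O)>0$. Then any $k$-batch greedy solution $S$ satisfies $$\frac{f(S)}{f(O)}\ \ge\ \frac{1}{1+c_k}.$$
   Context: Polymatroid set function: $f:2^X\to\mathbb{R}$ with $f(\emptyset)=0$ that is nondecreasing ($f(A)\le f(B)$ for $A\subseteq B\subseteq X$) and submodular ($f(A\cup\{j\})-f(A)\ge f(B\cup\{j\})-f(B)$ for $A\subseteq B\subseteq X$, $j\in X\setminus B$). Notation: $\varrho_T(A)=f(A\cup T)-f(A)$ for $A,T\subseteq X$, and $\varrho_j=\varrho_{\{j\}}$. Total curvature: $c=\max_{j\in X^*}\left\{1-\frac{\varrho_j(X\setminus\{j\})}{\varrho_j(\emptyset)}\right\}$, where $X^*=\{j\in X:\varrho_j(\emptyset)\ne 0\}$. Total $k$-batch curvature: $c_k=\max_{I\in\hat X}\left\{1-\frac{\varrho_I(X\setminus I)}{\varrho_I(\emptyset)}\right\}$, where $\hat X=\{I\subseteq X:\varrho_I(\emptyset)\ne 0,\ |I|=k\}$. $k$-batch greedy solution: write $K=kl+m$ with integers $l\ge 0$ and $0<m\le k$ (so $m=k$ when $k$ divides $K$). Put $S^0=\emptyset$. For $t=0,\dots,l-1$, choose $J_{t+1}$ maximizing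 $f(S^t\cup J)$ over all $J\subseteq X\setminus S^t$ with $|J|=k$ and $S^t\cup J\in\mathcal{I}$, and set $S^{t+1}=S^t\cup J_{t+1}$. Finally choose $J_{l+1}$ maximizing $f(S^l\cup J)$ over all $J\subseteq X\setminus S^l$ with $|J|=m$ and $S^l\cup J\in\mathcal{I}$. Any set $S=S^l\cup J_{l+1}$ obtained this way (with any tie-breaking) is a $k$-batch greedy solution. *)

(* Defs.v *)
From mathcomp Require Import all_boot all_order all_algebra.

Set Implicit Arguments.
Unset Strict Implicit.
Unset Printing Implicit Defensive.

Import Order.TTheory GRing.Theory Num.Theory.
Local Open Scope ring_scope.

Definition is_matroid (X : finType) (Ind : {set {set X}}) : Prop :=
  [/\ set0 \in Ind,
      forall A B : {set X}, B \in Ind -> A \subset B -> A \in Ind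
    & forall A B : {set X}, A \in Ind -> B \in Ind -> (#|A| < #|B|)%N ->
        exists2 j, j \in B :\: A & j |: A \in Ind].

Definition polymatroid (R : realFieldType) (X : finType) (f : {set X} -> R) :
    Prop :=
  [/\ f set0 = 0,
      forall A B : {set X}, A \subset B -> f A <= f B
    & forall (A B : {set X}) (j : X), A \subset B -> j \notin B ->
        f (j |: B) - f B <= f (j |: A) - f A].

(* The increment of f at A when T is added (written rho_T(A), T first). *)
Definition marginal (R : realFieldType) (X : finType) (f : {set X} -> R)
    (T A : {set X}) : R :=
  f (A :|: T) - f A.

(* The maximum of F over the elements satisfying P; the value 0 for an empty
   range is a dummy, see max_overP. *)
Definition max_over (R : realFieldType) (T : finType) (P : pred T)
    (F : T -> R) : R :=
  if [pick x | P x] is Some x0 then F [arg max_(x > x0 | P x) F x]%O else 0.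

Lemma max_overP (R : realFieldType) (T : finType) (P : pred T) (F : T -> R)
    (x0 : T) :
  P x0 ->
  (exists2 x, P x & max_over P F = F x)
  /\ (forall y, P y -> F y <= max_over P F).
Proof.
move=> Px0; rewrite /max_over; case: pickP => [x1 Px1|P0]; last first.
  by rewrite P0 in Px0.
by case: arg_maxP => // i Pi maxi; split; [exists i | exact: maxi].
Qed.

Definition total_curvature (R : realFieldType) (X : finType)
    (f : {set X} -> R) : R :=
  max_over (fun j : X => marginal f [set j] set0 != 0)
    (fun j : X =>
       1 - marginal f [set j] (~: [set j]) / marginal f [set j] set0).

Definition batch_curvature (R : realFieldType) (X : finType)
    (f : {set X} -> R) (k : nat) : R :=
  max_over (fun I : {set X} => (marginal f I set0 != 0) && (#|I| == k))
    (fun I : {set X} => 1 - marginal f I (~: I) / marginal f I set0).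

Definition feasible_batch (X : finType) (Ind : {set {set X}}) (s : nat)
    (A J : {set X}) : Prop :=
  [/\ J \subset ~: A, #|J| = s & A :|: J \in Ind].

Definition greedy_batch (R : realFieldType) (X : finType)
    (Ind : {set {set X}}) (f : {set X} -> R) (s : nat) (A J : {set X}) : Prop :=
  feasible_batch Ind s A J /\
  (forall J' : {set X}, feasible_batch Ind s A J' ->
     f (A :|: J') <= f (A :|: J)).

(* Here K is the rank of the matroid; l and m are determined by k and K. *)
Definition batch_greedy_solution (R : realFieldType) (X : finType)
    (Ind : {set {set X}}) (f : {set X} -> R) (K k : nat) (S : {set X}) : Prop :=
  exists l m : nat, [/\ K = (k * l + m)%N, (0 < m <= k)%N &
    exists St J : nat -> {set X},
      [/\ St 0%N = set0,
          forall t : nat, (t < l)%N ->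
            greedy_batch Ind f k (St t) (J t.+1) /\
            St t.+1 = St t :|: J t.+1,
          greedy_batch Ind f m (St l) (J l.+1)
        & S = St l :|: J l.+1]].

Definition optimal_solution (R : realFieldType) (X : finType)
    (Ind : {set {set X}}) (f : {set X} -> R) (O : {set X}) : Prop :=
  O \in Ind /\ (forall M : {set X}, M \in Ind -> f M <= f O).

(* Main.v *)
Require Import Defs.
From mathcomp Require Import all_boot all_order all_algebra.
From mathcomp Require Import lra.

Set Implicit Arguments.
Unset Strict Implicit.
Unset Printing Implicit Defensive.

Import Order.TTheory GRing.Theory Num.Theory.
Local Open Scope ring_scope.

(** The optimum may be replaced by a base [Q] containing it.  Write
    [g D = f X - f (X \ D)] ([removal_loss]) for the loss caused by deleting
    [D] from the whole set [X], let [S1] be the first greedy batch, which has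
    exactly [k] elements, and put [A = S1 :|: (S :\: Q)].  The proof estimates
    [f (S :|: Q)] from both sides.

    - From above, [f (S :|: Q) - f S <= f A - f (S1 :&: Q)]
      ([greedy_chain_gain_le]).  Going through the batches backwards, the
      exchange property removes from [Q] a competitor of each greedy batch [J],
      of the same size and containing [J :&: Q]; since greedy preferred [J],
      the competitor gains at most what [J :\: Q] gained on top of [J :&: Q].
      These gains telescope by diminishing returns.
    - From below, [f (S :|: Q) - f Q >= g (S :\: Q) >= g A - f (S1 :&: Q)],
      again by diminishing returns.

    The terms [f (S1 :&: Q)] cancel and leave [f Q <= f S + f A - g A].  By
    definition of the batch curvature [c], [g I >= (1 - c) f I] when
    [#|I| = k].  The same inequality holds for every larger set
    ([removal_loss_ge]), because the difference of the two sides is a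
    supermodular function of [I], for which nonnegativity passes from [k]-sets
    to larger sets by averaging.  It applies to [A], which contains [S1], so
    [f Q <= f S + c * f A <= (1 + c) * f S].

    Comparing with [A] as a whole, rather than batch by batch, is what copes
    with a last batch of fewer than [k] elements, about which [c] alone says
    nothing. *)

(** * Supermodular functions *)

Section Supermodular.
Variables (R : realFieldType) (X : finType) (h : {set X} -> R).
Hypothesis h_supermod : forall A B, h A + h B <= h (A :|: B) + h (A :&: B).

(** Each element of [B] is worth most when it is removed from the whole of
    [A], so removing [B] one element at a time loses no more than this sum. *)
Lemma supermodular_sum_removals (A B : {set X}) :
  B \subset A -> h A - h (A :\: B) <= \sum_(x in B) (h A - h (A :\ x)).
Proof.
move: {2}#|B| (leqnn #|B|) => n; elim: n B => [|n IHn] B leBn sBA.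
  move: leBn; rewrite leqn0 cards_eq0 => /eqP ->.
  by rewrite big_set0 setD0 subrr.
have [-> | [x xB]] := set_0Vmem B; first by rewrite big_set0 setD0 subrr.
have xA : x \in A by rewrite (subsetP sBA).
rewrite (big_setD1 x) //=.
have /IHn IH : (#|B :\ x| <= n)%N by move: leBn; rewrite (cardsD1 x) xB.
have {}IH := IH (subset_trans (subsetDl _ _) sBA).
have := h_supermod (A :\ x) (A :\: (B :\ x)).
have -> : A :\ x :|: (A :\: (B :\ x)) = A.
  apply/setP=> y; rewrite !inE; case: (eqVneq y x) => [->|_] /=.
    by rewrite xA.
  by case: (y \in A); rewrite ?andbF ?orbF.
have -> : (A :\ x) :&: (A :\: (B :\ x)) = A :\: B.
  apply/setP=> y; rewrite !inE; case: (eqVneq y x) => [->|_] /=.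
    by rewrite xB.
  by case: (y \in A); case: (y \in B).
lra.
Qed.

(** Averaging over the sets [A :\ x] gives
    [(#|A| - 1) * h A >= \sum_(x in A) h (A :\ x)], and the right-hand side is
    nonnegative by induction on [#|A|]. *)
Lemma supermodular_ge0_of_card (k : nat) :
    h set0 = 0 -> (0 < k)%N -> (forall I : {set X}, #|I| = k -> 0 <= h I) ->
  forall A : {set X}, (k <= #|A|)%N -> 0 <= h A.
Proof.
move=> h0 k_gt0 hk A lekA.
have [d Ed] : exists d, #|A| = (k + d)%N by exists (#|A| - k)%N; rewrite subnKC.
elim: d A Ed {lekA} => [|d IHd] A Ed; first by apply: hk; rewrite Ed addn0.
have := supermodular_sum_removals (subxx A).
rewrite setDv h0 subr0 sumrB sumr_const Ed addnS mulrSr => le_sum.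
have sum_ge0 : 0 <= \sum_(x in A) h (A :\ x).
  apply: sumr_ge0 => x xA; apply: IHd.
  by move: Ed; rewrite (cardsD1 x) xA addnS => -[].
have: 0 <= h A *+ (k + d) by lra.
by rewrite pmulrn_lge0 // addn_gt0 k_gt0.
Qed.

End Supermodular.

(** * Polymatroid functions *)

Section Polymatroid.
Variables (R : realFieldType) (X : finType) (f : {set X} -> R).
Hypothesis hf : polymatroid f.

Let f0 : f set0 = 0. Proof. by case: hf. Qed.
Let f_mono (A B : {set X}) : A \subset B -> f A <= f B.
Proof. by case: hf => _ + _; apply. Qed.

Lemma polymatroid_ge0 A : 0 <= f A.
Proof. by rewrite -f0 f_mono ?sub0set. Qed.

Lemma polymatroid_diminishing (A B T : {set X}) :
  A \subset B -> f (B :|: T) - f B <= f (A :|: T) - f A.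
Proof.
move: {2}#|T| (leqnn #|T|) => n; elim: n T => [|n IHn] T leTn sAB.
  move: leTn; rewrite leqn0 cards_eq0 => /eqP ->.
  by rewrite !setU0 !subrr.
have [-> | [x xT]] := set_0Vmem T; first by rewrite !setU0 !subrr.
have /IHn/(_ sAB) IH : (#|T :\ x| <= n)%N by move: leTn; rewrite (cardsD1 x) xT.
have split_x C : C :|: T = x |: (C :|: (T :\ x)).
  by rewrite setUCA setD1K.
have sAB' : A :|: (T :\ x) \subset B :|: (T :\ x) by rewrite setSU.
rewrite !split_x; have [xB | xB] := boolP (x \in B :|: (T :\ x)).
  rewrite (setUidPr (_ : [set x] \subset B :|: _)) ?sub1set //.
  apply: le_trans IH _; rewrite lerD2r; apply: f_mono; exact: subsetUr.
have [_ _ /(_ _ _ _ sAB' xB)] := hf; lra.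
Qed.

Lemma polymatroid_submodular (A B : {set X}) :
  f (A :|: B) + f (A :&: B) <= f A + f B.
Proof.
have := polymatroid_diminishing B (subsetIl A B).
by rewrite setUC setUIl setUid (setIidPr (subsetUr A B)) setUC; lra.
Qed.

(** * Batch curvature *)

Definition removal_loss (D : {set X}) : R := f setT - f (~: D).

Lemma marginal0 (I : {set X}) : marginal f I set0 = f I.
Proof. by rewrite /marginal set0U f0 subr0. Qed.

Lemma marginalC (I : {set X}) : marginal f I (~: I) = removal_loss I.
Proof. by rewrite /marginal setUC setUCr. Qed.

Lemma removal_loss_ge0 I : 0 <= removal_loss I.
Proof. by rewrite subr_ge0 f_mono ?subsetT. Qed.

Lemma removal_loss_le I : removal_loss I <= f I.
Proof.
by have := polymatroid_diminishing I (sub0set (~: I));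
   rewrite set0U f0 subr0 setUC setUCr.
Qed.

Let nonzero_batch k : pred {set X} :=
  fun I => (marginal f I set0 != 0) && (#|I| == k).

(** The first alternative covers the dummy value taken when [f] vanishes on
    all [k]-sets. *)
Lemma batch_curvature_attained k :
  batch_curvature f k = 0 \/
  exists2 I, 0 < f I & batch_curvature f k = 1 - removal_loss I / f I.
Proof.
have [I PI | P0] := pickP (nonzero_batch k); last first.
  left; rewrite /batch_curvature /max_over; case: pickP => // I PI.
  by have := P0 I; rewrite /nonzero_batch PI.
right; have [[I' /andP[nz _] eqc] _] :=
  max_overP (fun I => 1 - marginal f I (~: I) / marginal f I set0) PI.
exists I'; first by rewrite lt_def polymatroid_ge0 andbT -marginal0.
by rewrite -marginalC -[X in _ / X]marginal0.
Qed.

Lemma batch_curvature_ge0 k : 0 <= batch_curvature f k.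
Proof.
have [-> // | [I fI_gt0 ->]] := batch_curvature_attained k.
by rewrite subr_ge0 ler_pdivrMr // mul1r removal_loss_le.
Qed.

Lemma batch_curvature_le1 k : batch_curvature f k <= 1.
Proof.
have [-> | [I fI_gt0 ->]] := batch_curvature_attained k; first exact: ler01.
by rewrite gerBl divr_ge0 ?removal_loss_ge0 // ltW.
Qed.

Lemma removal_loss_ge_of_card k (I : {set X}) :
  #|I| = k -> (1 - batch_curvature f k) * f I <= removal_loss I.
Proof.
move=> cI; have [fI0 | nz] := eqVneq (f I) 0.
  by rewrite fI0 mulr0 removal_loss_ge0.
have fI_gt0 : 0 < f I by rewrite lt_def nz polymatroid_ge0.
have PI : nonzero_batch k I by rewrite /nonzero_batch marginal0 nz cI eqxx.
have [_ /(_ I PI)] :=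
  max_overP (fun I => 1 - marginal f I (~: I) / marginal f I set0) PI.
rewrite marginal0 marginalC -/(batch_curvature f k) => le_c.
by rewrite -ler_pdivlMr // lerBlDr -lerBlDl.
Qed.

(** In classical terms, the total [n]-batch curvature is nonincreasing in
    [n].  Complementation turns the submodular [f] into the supermodular
    [removal_loss], and [1 - batch_curvature f k >= 0], so the difference of
    the two sides is supermodular. *)
Lemma removal_loss_ge k (A : {set X}) : (0 < k <= #|A|)%N ->
  (1 - batch_curvature f k) * f A <= removal_loss A.
Proof.
move=> /andP[k_gt0 lekA]; rewrite -subr_ge0.
pose h A := removal_loss A - (1 - batch_curvature f k) * f A.
apply: (@supermodular_ge0_of_card _ _ h _ k) => // [B C||I cI]; last first.
- by rewrite subr_ge0; apply: removal_loss_ge_of_card.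
- by rewrite /h /removal_loss setC0 subrr f0 mulr0 subr0.
have c_le1 : 0 <= 1 - batch_curvature f k.
  by rewrite subr_ge0 batch_curvature_le1.
have := ler_wpM2l c_le1 (polymatroid_submodular B C).
have := polymatroid_submodular (~: B) (~: C).
rewrite -setCU -setCI !mulrDr /h /removal_loss; lra.
Qed.

(** * Matroid exchange along a greedy chain *)

Variable Ind : {set {set X}}.
Hypothesis hInd : is_matroid Ind.

Lemma matroid_augment (A B : {set X}) :
    A \in Ind -> B \in Ind -> (#|A| <= #|B|)%N ->
  exists J : {set X},
    [/\ J \subset B :\: A, #|J| = (#|B| - #|A|)%N & A :|: J \in Ind].
Proof.
move=> + BI leAB; have [_ _ exch] := hInd.
have [d Ed] : exists d, #|B| = (#|A| + d)%N.
  by exists (#|B| - #|A|)%N; rewrite subnKC.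
rewrite Ed addKn; elim: d A {leAB} Ed => [|d IHd] A Ed AI.
  by exists set0; rewrite sub0set cards0 setU0.
have ltAB : (#|A| < #|B|)%N by rewrite Ed addnS ltnS leq_addr.
have [x] := exch _ _ AI BI ltAB; rewrite inE => /andP[xA xB] xAI.
have [|J [sJ cJ JI]] := IHd (x |: A) _ xAI.
  by rewrite cardsU1 xA Ed addnS.
have xJ : x \notin J.
  by apply/negP => /(subsetP sJ); rewrite !inE eqxx.
exists (x |: J); split; last by rewrite setUCA setUA.
- rewrite subUset sub1set inE xA xB (subset_trans sJ) //.
  by rewrite setDS ?subsetUr.
- by rewrite cardsU1 xJ cJ.
Qed.

(** The competitor of the batch [J] is [Q :\: Q'].  Starting the augmentation
    from [S0 :|: (J :&: Q)] rather than [S0] puts all of [J :&: Q] into the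
    competitor and keeps the trace of [Q] on [S0] unchanged; comparing gains
    on top of [S0 :|: (J :&: Q)] then compares only the parts that differ. *)
Lemma greedy_batch_exchange s (S0 J Q Y : {set X}) :
    greedy_batch Ind f s S0 J -> Q \in Ind -> #|Q| = #|S0 :|: J| ->
    S0 :|: J \subset Y ->
  exists Q' : {set X}, [/\ Q' \in Ind, #|Q'| = #|S0|, Q' :&: S0 = Q :&: S0
    & f (Y :|: Q) - f (Y :|: Q') <= f (S0 :|: J) - f (S0 :|: (J :&: Q))].
Proof.
move=> [[sJ cJ SJI] gJ] QI cQ sY; have [_ sub_ind _] := hInd.
have sST : S0 :|: (J :&: Q) \subset S0 :|: J by rewrite setUS ?subsetIl.
have STI : S0 :|: (J :&: Q) \in Ind by exact: sub_ind SJI sST.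
have leST : (#|S0 :|: (J :&: Q)| <= #|Q|)%N by rewrite cQ subset_leq_card.
have [P [sP cP PI]] := matroid_augment STI QI leST.
have dS0 (V : {set X}) : V \subset ~: S0 -> #|S0 :|: V| = (#|S0| + #|V|)%N.
  move=> sV; rewrite cardsU (_ : S0 :&: V = set0) ?cards0 ?subn0 //.
  by apply/eqP; rewrite setI_eq0 disjoint_sym disjoints_subset.
pose J' := (J :&: Q) :|: P.
have sPQ : P \subset Q := subset_trans sP (subsetDl _ _).
have sJ'Q : J' \subset Q by rewrite subUset subsetIr.
have sJ'S0 : J' \subset ~: S0.
  rewrite subUset (subset_trans (subsetIl _ _) sJ) (subset_trans sP) //.
  by apply/subsetP => x; rewrite !inE negb_or => /andP[/andP[]].
have cSJ' : #|S0 :|: J'| = #|Q|.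
  rewrite setUA cardsU (_ : _ :&: P = set0) ?cards0 ?subn0.
    by rewrite cP subnKC.
  apply/eqP; rewrite setI_eq0 disjoint_sym disjoints_subset (subset_trans sP) //.
  by apply/subsetP => x; rewrite !inE => /andP[].
have cJ' : #|J'| = #|J|.
  by apply/eqP; rewrite -(eqn_add2l #|S0|) -!dS0 // cSJ' cQ.
have leJ' : f (S0 :|: J') <= f (S0 :|: J).
  by apply: gJ; split; [|rewrite cJ' | rewrite setUA].
exists (Q :\: J'); split.
- exact: sub_ind QI (subsetDl _ _).
- rewrite cardsD (setIidPr sJ'Q) cJ' cQ dS0 //; exact: addnK.
- apply/setP => x; rewrite !inE; have [xS | ] := boolP (x \in S0);
    last by rewrite !andbF.
  have : x \notin J'.
    by apply/negP => /(subsetP sJ'S0); rewrite inE xS.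
  by rewrite !inE => ->.
have sTY : S0 :|: (J :&: Q) \subset Y :|: (Q :\: J').
  exact: subset_trans sST (subset_trans sY (subsetUl _ _)).
have dim := polymatroid_diminishing J' sTY.
have EQ : Y :|: (Q :\: J') :|: J' = Y :|: Q.
  by rewrite -setUA [X in Y :|: X]setUC -{1}(setIidPr sJ'Q) setID.
have ES : S0 :|: (J :&: Q) :|: J' = S0 :|: J'.
  by rewrite -setUA; congr (_ :|: _); rewrite /J' setUA setUid.
by rewrite EQ ES in dim; apply: le_trans dim _; rewrite lerD2r.
Qed.

Lemma chain_first_sub (Sq J : nat -> {set X}) (s : nat -> nat) (n : nat) :
    (forall t, (t <= n)%N -> greedy_batch Ind f (s t) (Sq t) (J t.+1)
                             /\ Sq t.+1 = Sq t :|: J t.+1) ->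
  Sq 1%N \subset Sq n.+1.
Proof.
elim: n => // n IHn chain; have [_ ->] := chain n.+1 (leqnn _).
by rewrite (subset_trans (IHn _)) ?subsetUl // => t le_tn; apply/chain/leqW.
Qed.

(** Along the chain, the part of each batch outside [Q] is added to
    [Sq 1 :|: (Sq n :\: Q)], a smaller set than the one to which greedy added
    it, hence with a larger gain; this is how the bounds of
    [greedy_batch_exchange] telescope.  The first batch enters whole, so that
    the set on the right has at least as many elements as that batch. *)
Lemma greedy_chain_gain_le (Sq J : nat -> {set X}) (s : nat -> nat) (n : nat)
    (Q Y : {set X}) :
    Sq 0%N = set0 ->
    (forall t, (t <= n)%N -> greedy_batch Ind f (s t) (Sq t) (J t.+1)
                             /\ Sq t.+1 = Sq t :|: J t.+1) ->
    Q \in Ind -> #|Q| = #|Sq n.+1| -> Sq n.+1 \subset Y ->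
  f (Y :|: Q) - f Y <= f (Sq 1%N :|: (Sq n.+1 :\: Q)) - f (Sq 1%N :&: Q).
Proof.
move=> S00; elim: n Q => [|n IHn] Q chain QI cQ sY.
  have [gJ ES] := chain 0%N (leqnn _).
  have [||Q' [_ cQ' _]] := greedy_batch_exchange gJ QI _ (Y := Y);
  rewrite -?ES //.
  have -> : Q' = set0 by apply/eqP; rewrite -cards_eq0 cQ' S00 cards0.
  by rewrite ES S00 !set0U !setU0 (setUidPl (subsetDl _ _)).
have [gJ ES] := chain n.+1 (leqnn _).
have [||Q' [Q'I cQ' trace gain]] := greedy_batch_exchange gJ QI _ (Y := Y);
  rewrite -?ES //.
have sSY : Sq n.+1 \subset Y by rewrite (subset_trans _ sY) // ES subsetUl.
have {IHn} IH := IHn Q' (fun t le_tn => chain t (leqW le_tn)) Q'I cQ' sSY.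
have sS1 : Sq 1%N \subset Sq n.+1.
  by apply: (chain_first_sub (s := s) (J := J)) => t le_tn; apply/chain/leqW.
have traceS (V : {set X}) : V \subset Sq n.+1 -> V :&: Q' = V :&: Q.
  move=> /setIidPl <-.
  by rewrite -!setIA (setIC _ Q') (setIC _ Q) trace.
have ED : Sq n.+1 :\: Q' = Sq n.+1 :\: Q.
  apply/setP => x; move/setP/(_ x): trace; rewrite !inE.
  by case: (x \in Sq n.+1); rewrite ?andbT ?andbF // => ->.
rewrite traceS // ED in IH.
have sA : Sq 1%N :|: (Sq n.+1 :\: Q) \subset Sq n.+1 :|: (J n.+2 :&: Q).
  by rewrite (subset_trans _ (subsetUl _ _)) // subUset sS1 subsetDl.
have := polymatroid_diminishing (J n.+2 :\: Q) sA.
rewrite -!setUA setID -ES -setDUl -ES; move: gain; rewrite -ES; lra.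
Qed.

(** [f (Sq n.+1 :|: Q)] is squeezed between [up] and [low]; [lossA] makes the
    two occurrences of [f (Sq 1 :&: Q)] cancel. *)
Lemma greedy_chain_bound (Sq J : nat -> {set X}) (s : nat -> nat) (n k : nat)
    (Q : {set X}) :
    Sq 0%N = set0 ->
    (forall t, (t <= n)%N -> greedy_batch Ind f (s t) (Sq t) (J t.+1)
                             /\ Sq t.+1 = Sq t :|: J t.+1) ->
    (0 < k <= s 0%N)%N -> Q \in Ind -> #|Q| = #|Sq n.+1| ->
  f Q <= (1 + batch_curvature f k) * f (Sq n.+1).
Proof.
move=> S00 chain /andP[k_gt0 leks] QI cQ.
set c := batch_curvature f k.
have sS1 := chain_first_sub chain.
pose A := Sq 1%N :|: (Sq n.+1 :\: Q).
have leA : (k <= #|A|)%N.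
  have [[[_ cJ _] _] ES] := chain 0%N (leq0n _).
  apply: leq_trans leks _; rewrite -cJ -[J 1%N]set0U -S00 -ES.
  by rewrite subset_leq_card ?subsetUl.
have up := greedy_chain_gain_le S00 chain QI cQ (subxx _).
have low : removal_loss (Sq n.+1 :\: Q) <= f (Sq n.+1 :|: Q) - f Q.
  have sQ : Q \subset ~: (Sq n.+1 :\: Q).
    by apply/subsetP => x xQ; rewrite !inE xQ.
  have := polymatroid_diminishing (Sq n.+1 :\: Q) sQ.
  have -> : Q :|: (Sq n.+1 :\: Q) = Sq n.+1 :|: Q.
    by apply/setP => x; rewrite !inE; case: (x \in Q); rewrite ?orbT ?orbF.
  by rewrite setUC setUCr.
have lossA : removal_loss A <= removal_loss (Sq n.+1 :\: Q) + f (Sq 1%N :&: Q).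
  have := polymatroid_diminishing (Sq 1%N :&: Q) (sub0set (~: A)).
  rewrite set0U f0 subr0.
  have -> : ~: A :|: Sq 1%N :&: Q = ~: (Sq n.+1 :\: Q).
    apply/setP => x; rewrite !inE.
    case: (x \in Sq 1%N) (subsetP sS1 x) => [/(_ isT) ->|_] /=;
      last by rewrite orbF.
    by case: (x \in Q).
  rewrite /removal_loss; lra.
have curv : (1 - c) * f A <= removal_loss A.
  by apply: removal_loss_ge; rewrite k_gt0.
have sAS : f A <= f (Sq n.+1).
  by apply: f_mono; rewrite subUset sS1 subsetDl.
have := ler_wpM2l (batch_curvature_ge0 k) sAS.
rewrite mulrBl mul1r in curv.
rewrite -/c -/A in up *; rewrite mulrDl mul1r; lra.
Qed.

End Polymatroid.

Theorem theorem3p1 (R : realFieldType) (X : finType) (Ind : {set {set X}})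
    (K k : nat) (f : {set X} -> R) (O S : {set X})
    (hInd : is_matroid Ind)
    (hrank : forall B : {set X}, maxset (fun A => A \in Ind) B -> #|B| = K)
    (hK : (1 <= K)%N) (hk : (1 <= k <= K)%N)
    (hf : polymatroid f)
    (hc : 0 < total_curvature f <= 1)
    (hO : optimal_solution Ind f O) (hfO : 0 < f O)
    (hS : batch_greedy_solution Ind f K k S) :
  f S / f O >= 1 / (1 + batch_curvature f k).
Proof.
have [OI _] := hO.
(* A base containing [O] is needed because the exchange argument compares sets
   of equal size. *)
have [Q maxQ sOQ] := maxset_exists (OI : (fun A => A \in Ind) O).
have QI : Q \in Ind := maxsetp maxQ.
have fOQ : f O <= f Q by case: hf => _ + _; apply.
have c_ge0 := batch_curvature_ge0 hf k.
have [l [m [EK /andP[m_gt0 lemk] [St [J [St0 steps last ES]]]]]] := hS.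
pose Sq t := if (t <= l)%N then St t else S.
pose s t := if (t < l)%N then k else m.
have chain t : (t <= l)%N ->
    greedy_batch Ind f (s t) (Sq t) (J t.+1) /\ Sq t.+1 = Sq t :|: J t.+1.
  rewrite /Sq /s => le_tl; rewrite le_tl.
  have [lt_tl | ge_tl] := ltnP t l; first exact: steps.
  by have -> : t = l by apply/eqP; rewrite eqn_leq le_tl.
have cSq t : (t <= l)%N -> #|Sq t.+1| = (#|Sq t| + s t)%N.
  move=> /chain [[[sJ <- _] _] ->].
  rewrite cardsU (_ : _ :&: _ = set0) ?cards0 ?subn0 //.
  by apply/eqP; rewrite setI_eq0 disjoint_sym disjoints_subset.
have cSqk t : (t <= l)%N -> #|Sq t| = (k * t)%N.
  elim: t => [_|t IHt lt_tl]; first by rewrite /Sq St0 cards0 muln0.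
  by rewrite cSq 1?ltnW // IHt 1?ltnW // /s lt_tl mulnS addnC.
have ESq : Sq l.+1 = S by rewrite /Sq ltnn.
have cQ : #|Q| = #|Sq l.+1|.
  by rewrite (hrank Q maxQ) EK cSq // cSqk // /s ltnn.
(* Without a full batch the first batch has [m] elements, but then
   [m = K >= k]. *)
have lek_s0 : (0 < k <= s 0%N)%N.
  have /andP[k_gt0 lekK] := hk; rewrite k_gt0 /s.
  have [l0 | _] := posnP l; last exact: leqnn.
  by rewrite EK l0 muln0 add0n in lekK.
have Sq0 : Sq 0%N = set0 by rewrite /Sq St0.
have := greedy_chain_bound hf hInd Sq0 chain lek_s0 QI cQ; rewrite ESq => bound.
rewrite ler_pdivlMr // mulrAC ler_pdivrMr ?mul1r; last by rewrite ltr_pwDl.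
by rewrite mulrC (le_trans fOQ).
Qed.
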